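(* Let $R$ be a unital ring with involution, let $a\in R$ and let $n$ be a positive integer. Then $a$ is an EP element if and only if $a$ is Moore-Penrose invertible, group invertible and $n$-EP.
   Context: A unital (associative, not necessarily commutative) ring with involution is a unital ring $R$ with a map $a\mapsto a^*$ satisfying $(a^* )^*=a$, $(ab)^*=b^*a^*$, $(a+b)^*=a^*+b^*$ for all $a,b\in R$. Notation: $[a,b]=ab-ba$. The Moore-Penrose inverse of $a\in R$ is the element $a^\dagger=x$ (unique if it exists) with $axa=a$, $xax=x$, $(ax)^*=ax$, $(xa)^*=xa$; the group inverse of $a$ is the element $a^\#=x$ (unique if it exists) with $axa=a$, $xax=x$, $ax=xa$. An element $a\in R$ is EP if it is both Moore-Penrose invertible and group invertible and $a^\dagger=a^\#$. For a positive integer $n$, an element $a\in R$ is $n$-EP if $a$ is Moore-Penrose invertible and $[a^na^\dagger,a^\dagger a^n]=0$. *)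

(* Defs.v *)
From mathcomp Require Import all_boot all_algebra.

Set Implicit Arguments.
Unset Strict Implicit.
Unset Printing Implicit Defensive.

Import GRing.Theory.
Local Open Scope ring_scope.

(* Rings are pzRingType: unital, not necessarily commutative, and the zero ring
   (1 = 0) is allowed.
   Moore-Penrose and group inverses are rendered relationally, since they are
   unique but need not exist. *)

Definition is_involution (R : pzRingType) (star : R -> R) : Prop :=
  [/\ forall a : R, star (star a) = a,
      forall a b : R, star (a * b) = star b * star a
    & forall a b : R, star (a + b) = star a + star b].

Definition commutator (R : pzRingType) (a b : R) : R := a * b - b * a.

Definition is_MP_inverse (R : pzRingType) (star : R -> R) (a x : R) : Prop :=
  [/\ a * x * a = a, x * a * x = x,
      star (a * x) = a * x & star (x * a) = x * a].

Definition is_group_inverse (R : pzRingType) (a x : R) : Prop :=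
  [/\ a * x * a = a, x * a * x = x & a * x = x * a].

Definition MP_invertible (R : pzRingType) (star : R -> R) (a : R) : Prop :=
  exists x : R, is_MP_inverse star a x.

Definition group_invertible (R : pzRingType) (a : R) : Prop :=
  exists x : R, is_group_inverse a x.

Definition EP (R : pzRingType) (star : R -> R) (a : R) : Prop :=
  exists x y : R, [/\ is_MP_inverse star a x, is_group_inverse a y & x = y].

Definition nEP (R : pzRingType) (star : R -> R) (n : nat) (a : R) : Prop :=
  exists x : R,
    is_MP_inverse star a x /\ commutator (a ^+ n * x) (x * a ^+ n) = 0.

(* Main.v *)
Require Import Defs.
From mathcomp Require Import all_boot all_algebra.

Set Implicit Arguments.
Unset Strict Implicit.
Unset Printing Implicit Defensive.

Import GRing.Theory.
Local Open Scope ring_scope.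

(** Let [x] be a Moore-Penrose inverse of [a]. Being EP amounts to
    [a * x = x * a], and then [x] commutes with every power of [a], so the
    [n]-EP condition is immediate.

    Conversely, the [n]-EP condition reads
      [a ^+ n * x * x * a ^+ n = x * a ^+ (n + n) * x].
    Multiplying it by [a] on the left turns the right-hand side into
    [a ^+ (n + n) * x], and group invertibility lets one cancel the power down
    to [a * x] ([group_inverse_cancell]); hence [a * x] is a left multiple of
    [a], so it absorbs [x * a] on the right. Symmetrically, [x * a] is a right
    multiple of [a], so it absorbs [a * x] on the left. Therefore
      [a * x = a * x * (x * a) = x * a]. *)

(** The element [a * g] fixes [a], so the powers of [g] undo those of [a] as
    long as one factor [a] is left over. *)
Lemma group_inverse_cancell (R : pzRingType) (a g : R) (m : nat) :
  is_group_inverse a g -> g ^+ m * a ^+ m.+1 = a.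
Proof.
case=> aga _ ag_ga; elim: m => [|m IHm]; first by rewrite mul1r.
have gaa : g * a * a = a by rewrite -ag_ga aga.
rewrite exprSr (exprS a m.+1) (exprS a m) -mulrA !(mulrA g) (mulrA (g * a)).
by rewrite gaa -exprS.
Qed.

Lemma group_inverse_cancelr (R : pzRingType) (a g : R) (m : nat) :
  is_group_inverse a g -> a ^+ m.+1 * g ^+ m = a.
Proof.
move=> gi; have [_ _ ag_ga] := gi.
rewrite -[RHS](group_inverse_cancell m gi).
exact: commrX (commr_sym (commrX _ (commr_sym ag_ga))).
Qed.

(** Both products equal [a * x * (x * a)]: the commutator equation and
    the cancellation of powers put [a * x] in [R * a] and [x * a] in [a * R]. *)
Lemma inner_inverse_comm (R : pzRingType) (a x g : R) (n : nat) :
    (0 < n)%N -> a * x * a = a -> is_group_inverse a g ->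
    commutator (a ^+ n * x) (x * a ^+ n) = 0 ->
  a * x = x * a.
Proof.
case: n => // m _ axa gi /eqP; rewrite subr_eq0 => /eqP nEPx.
have ax_pow k : a * x * a ^+ k.+1 = a ^+ k.+1 by rewrite exprS mulrA axa.
have pow_xa k : a ^+ k.+1 * (x * a) = a ^+ k.+1.
  by rewrite exprSr -mulrA (mulrA a) axa.
(* For [n = m.+1], the exponent [n + n] is spelled [(m + m.+1).+1], the form in
   which powers of the group inverse cancel all but one factor. *)
have pow_x : a ^+ (m + m.+1).+1 * x = a * (a ^+ m.+1 * x * (x * a ^+ m.+1)).
  by rewrite nEPx !mulrA ax_pow -exprD.
have x_pow : x * a ^+ (m + m.+1).+1 = a ^+ m.+1 * x * (x * a ^+ m.+1) * a.
  by rewrite nEPx -!mulrA pow_xa -exprD.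
have ax_absorb : a * x * (x * a) = a * x.
  rewrite -{1 3}(group_inverse_cancell (m + m.+1) gi) -!(mulrA (g ^+ _)).
  by rewrite pow_x -!mulrA pow_xa.
have xa_absorb : a * x * (x * a) = x * a.
  rewrite -{2 3}(group_inverse_cancelr (m + m.+1) gi) (mulrA x) x_pow.
  by rewrite !mulrA ax_pow.
by rewrite -ax_absorb xa_absorb.
Qed.

Theorem theorem4p3 (R : pzRingType) (star : R -> R)
    (star_inv : is_involution star) (a : R) (n : nat) (n_gt0 : (0 < n)%N) :
  EP star a <-> [/\ MP_invertible star a, group_invertible a & nEP star n a].
Proof.
split=> [[x [y [MPx + xy]]] | [_ [g gi] [x [MPx nEPx]]]].
  rewrite -{y}xy => gix.
  split; [by exists x | by exists x | exists x; split=> //].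
  have [_ _ ax_xa] := gix.
  have -> : a ^+ n * x = x * a ^+ n by apply/commr_sym/commrX/commr_sym.
  exact: subrr.
exists x, x; split=> //; have [axa xax _ _] := MPx.
split=> //; exact: inner_inverse_comm n_gt0 axa gi nEPx.
Qed.
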